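(* Let $s>0$, $t>0$ and $0<q<1$, and let $T=T(1,sq,q^2,tq^3,q^4,sq^5,q^6,tq^7,\ldots)$ be the weighted shift operator on $\ell^2(\mathbb{N})$ whose $k$-th weight is $q^{k-1}$ for $k$ odd, $sq^{k-1}$ for $k\equiv 2 \pmod 4$, and $tq^{k-1}$ for $k\equiv 0\pmod 4$. Then the numerical radius $w(T)$ satisfies: (a) $$w(T)\geq \sup_{0<z<1} \frac{(1-z)\sqrt z}{1-q^4z^4} \big((1+sqz)+q^2z^2(1+tqz)\big);$$ (b) $$w(T)\leq \frac{1}{2}\max\{1,sq,tq^3\} + \frac{\sqrt{sq}}{2}\,w(S),$$ where $S=T\big(1,q,\sqrt{\tfrac{t}{s}}\,q^2,\sqrt{\tfrac{t}{s}}\,q^3,q^4,q^5,\sqrt{\tfrac{t}{s}}\,q^6,\sqrt{\tfrac{t}{s}}\,q^7,q^8,q^9,\ldots\big)$ is the weighted shift operator whose $k$-th weight is $q^{k-1}$ if $k\equiv 1,2\pmod 4$ and $\sqrt{t/s}\,q^{k-1}$ if $k\equiv 3,0\pmod 4$.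
   Context: For a bounded sequence of weights $(w_1,w_2,\ldots)$, $T(w_1,w_2,\ldots)$ denotes the bounded operator on the complex Hilbert space $\ell^2(\mathbb{N})$, $\mathbb{N}=\{1,2,\ldots\}$, with standard orthonormal basis $\{e_k\}_{k\ge1}$, given by $Te_k=w_ke_{k+1}$. The numerical radius of a bounded operator $T$ is $w(T)=\sup\{|\langle Tx,x\rangle| : \|x\|=1\}$. *)

(* Defs.v *)
From HB Require Import structures.
From mathcomp Require Import all_boot all_order all_algebra.
From mathcomp Require Import all_classical all_reals all_analysis.
From mathcomp Require Import complex ring lra.

Set Implicit Arguments.
Unset Strict Implicit.
Unset Printing Implicit Defensive.

Import Order.TTheory GRing.Theory Num.Theory.
Import numFieldNormedType.Exports.

Local Open Scope ring_scope.
Local Open Scope classical_set_scope.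
Local Open Scope complex_scope.

(* Sequences indexed by {1, 2, ...} are represented by functions on nat, index
   [k] of nat standing for the index [k + 1]. *)

(* The absolute value of a complex number, as a real number ([`|z|] itself has
   type [R[i]]). *)
Definition cabs (R : realType) (z : R[i]) : R := complex.Re `|z|.

Definition l2 (R : realType) : set (nat -> R[i]) :=
  [set x | cvgn (series (fun k => cabs (x k) ^+ 2))].

Definition l2norm (R : realType) (x : nat -> R[i]) : R :=
  Num.sqrt (limn (series (fun k => cabs (x k) ^+ 2))).

(* The regular module [R[i]^o] carries the topology of the modulus on [R[i]]. *)
Definition l2dot (R : realType) (x y : nat -> R[i]) : R[i] :=
  limn (series (fun k => x k * (y k)^*) : nat -> R[i]^o).

Definition l2basis (R : realType) (k : nat) : nat -> R[i] :=
  fun j => (j == k)%:R.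

Definition weighted_shift (R : realType) (w : nat -> R[i]) (x : nat -> R[i]) :
    nat -> R[i] :=
  fun j => if j is k.+1 then w k * x k else 0.

Definition bounded_weights (R : realType) (w : nat -> R[i]) : Prop :=
  exists M : R, forall k, cabs (w k) <= M.

(* The supremum is taken in the extended reals, so that it is also meaningful
   for unbounded operators. *)
Definition numerical_radius (R : realType) (A : (nat -> R[i]) -> (nat -> R[i])) :
    \bar R :=
  ereal_sup [set (cabs (l2dot (A x) x))%:E | x in [set x | l2 x /\ l2norm x = 1]].

Definition weightsT (R : realType) (s t q : R) (k : nat) : R :=
  if (k %% 4 == 1)%N then s * q ^+ k
  else if (k %% 4 == 3)%N then t * q ^+ k
  else q ^+ k.

Definition weightsS (R : realType) (s t q : R) (k : nat) : R :=
  if (k %% 4 < 2)%N then q ^+ k else Num.sqrt (t / s) * q ^+ k.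

Lemma cabsE (R : realType) (z : R[i]) :
  cabs z = Num.sqrt (complex.Re z ^+ 2 + complex.Im z ^+ 2).
Proof. by rewrite /cabs normc_def. Qed.

Lemma cabs_ge0 (R : realType) (z : R[i]) : 0 <= cabs z.
Proof. by rewrite cabsE sqrtr_ge0. Qed.

Lemma cabs_real (R : realType) (a : R) : cabs a%:C = `|a|.
Proof. by rewrite cabsE /= expr0n addr0 sqrtr_sqr. Qed.

Lemma cabsM (R : realType) (z z' : R[i]) : cabs (z * z') = cabs z * cabs z'.
Proof.
by rewrite /cabs normrM 2!normc_def -rmorphM.
Qed.

Lemma cvg_real_complex (R : realType) (u : nat -> R) (a : R) :
  u @ \oo --> a -> (fun n => (u n)%:C : R[i]^o) @ \oo --> (a%:C : R[i]^o).
Proof.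
move=> /cvgrPdist_lt ua; apply/cvgrPdist_lt => -[e e'].
rewrite ltcE /= => /andP[/eqP-> e0].
apply: filterS (ua _ e0) => n h.
by rewrite -rmorphB /= normc_def /= expr0n addr0 sqrtr_sqr ltcR.
Qed.

Lemma cvg_complex (R : realType) (u : nat -> R[i]^o) (a b : R) :
  (fun n => complex.Re (u n)) @ \oo --> a ->
  (fun n => complex.Im (u n)) @ \oo --> b ->
  u @ \oo --> (a +i* b : R[i]^o).
Proof.
move=> /cvg_real_complex ua /cvg_real_complex ub.
have -> : u = (fun n => (complex.Re (u n))%:C : R[i]^o) \+
              (fun n => 'i * (complex.Im (u n))%:C).
  by apply/funext => n /=; rewrite -complexE.
rewrite [a +i* b]complexE.
refine (@cvgD R[i] R[i]^o _ _ _ _ _ _ _ ua _).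
refine (@cvgM R[i] _ _ _ _ _ _ _ _ ub).
exact: cvg_cst.
Qed.

Lemma is_cvg_l2dot (R : realType) (x y : nat -> R[i]) : l2 x -> l2 y ->
  cvgn (series (fun k => x k * (y k)^*) : nat -> R[i]^o).
Proof.
move=> lx ly.
have absE (z : R[i]) : cabs z ^+ 2 = complex.Re z ^+ 2 + complex.Im z ^+ 2.
  by rewrite cabsE sqr_sqrtr // addr_ge0 ?sqr_ge0.
have cvg_dominated (f : nat -> R) :
    (forall k, `|f k| <= cabs (x k) ^+ 2 + cabs (y k) ^+ 2) -> cvgn (series f).
  move=> fle; apply: normed_cvg; apply: (series_le_cvg _ _ fle) => [k|k|].
  - exact: normr_ge0.
  - by rewrite addr_ge0 // sqr_ge0.
  - have -> : series (fun k => cabs (x k) ^+ 2 + cabs (y k) ^+ 2) =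
        series (fun k => cabs (x k) ^+ 2) \+ series (fun k => cabs (y k) ^+ 2).
      by apply/funext => n; rewrite /series /= big_split.
    exact: is_cvgD.
have cre : cvgn (series (fun k => complex.Re (x k * (y k)^*))).
  apply: cvg_dominated => k; rewrite !absE.
  case: (x k) (y k) => a b [c d] /=; rewrite ler_norml.
  have := (sqr_ge0 (a + c), sqr_ge0 (b + d), sqr_ge0 (a - c), sqr_ge0 (b - d)).
  by move=> [[[h1 h2] h3] h4]; apply/andP; split; nra.
have cim : cvgn (series (fun k => complex.Im (x k * (y k)^*))).
  apply: cvg_dominated => k; rewrite !absE.
  case: (x k) (y k) => a b [c d] /=; rewrite ler_norml.
  have := (sqr_ge0 (a + d), sqr_ge0 (b + c), sqr_ge0 (a - d), sqr_ge0 (b - c)).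
  by move=> [[[h1 h2] h3] h4]; apply/andP; split; nra.
apply/cvg_ex; eexists; apply: cvg_complex.
- rewrite (_ : (fun n => _) = series (fun k => complex.Re (x k * (y k)^*))).
    exact: cre.
  by apply/funext => n; rewrite /series /= raddf_sum.
- rewrite (_ : (fun n => _) = series (fun k => complex.Im (x k * (y k)^*))).
    exact: cim.
  by apply/funext => n; rewrite /series /= raddf_sum.
Qed.

Lemma weighted_shift_basis (R : realType) (w : nat -> R[i]) (k : nat) :
  weighted_shift w (l2basis R k) = (fun j => w k * l2basis R k.+1 j).
Proof.
apply/funext => -[|j] /=; rewrite /l2basis ?mulr0 // eqSS.
by case: eqVneq => [->//|_]; rewrite !mulr0.
Qed.

Lemma series_weighted_shift (R : realType) (w x : nat -> R[i]) (M : R) (n : nat) :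
  (forall k, cabs (w k) <= M) ->
  series (fun k => cabs (weighted_shift w x k) ^+ 2) n <=
  M ^+ 2 * series (fun k => cabs (x k) ^+ 2) n.
Proof.
move=> wM; have M0 : 0 <= M := le_trans (cabs_ge0 _) (wM 0%N).
case: n => [|n]; first by rewrite /series /= !big_geq // mulr0.
have ge0 k : 0 <= cabs (x k) ^+ 2 by exact: exprn_ge0 (cabs_ge0 _).
rewrite /series /= big_nat_recl //= cabs_real normr0 expr0n /= add0r.
rewrite big_nat_recr //= mulrDr ler_wpDr ?mulr_ge0 ?exprn_ge0 ?cabs_ge0 //.
rewrite mulr_sumr ler_sum // => k _.
by rewrite cabsM exprMn ler_wpM2r // lerXn2r // nnegrE cabs_ge0.
Qed.

Lemma weighted_shift_l2 (R : realType) (w x : nat -> R[i]) :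
  bounded_weights w -> l2 x -> l2 (weighted_shift w x).
Proof.
move=> [M wM] lx.
have ndx (y : nat -> R[i]) : nondecreasing_seq (series (fun k => cabs (y k) ^+ 2)).
  by apply/nondecreasing_series => k _ _; exact: exprn_ge0 (cabs_ge0 _).
apply: nondecreasing_is_cvgn; first exact: ndx.
exists (M ^+ 2 * limn (series (fun k => cabs (x k) ^+ 2))) => _ [n _ <-].
apply: le_trans (series_weighted_shift x n wM) _.
rewrite ler_wpM2l ?sqr_ge0 //.
exact: nondecreasing_cvgn_le (ndx x) lx n.
Qed.

Lemma l2norm_weighted_shift (R : realType) (w x : nat -> R[i]) (M : R) :
  (forall k, cabs (w k) <= M) -> l2 x ->
  l2norm (weighted_shift w x) <= M * l2norm x.
Proof.
move=> wM lx; have M0 : 0 <= M := le_trans (cabs_ge0 _) (wM 0%N).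
have lTx : l2 (weighted_shift w x) by apply: weighted_shift_l2 => //; exists M.
rewrite /l2norm -[X in X * _](ger0_norm M0) -sqrtr_sqr -sqrtrM ?sqr_ge0 //.
apply: ler_wsqrtr; apply: limr_le => //.
apply: nearW => n; apply: le_trans (series_weighted_shift x n wM) _.
rewrite ler_wpM2l ?sqr_ge0 //; apply: nondecreasing_cvgn_le lx n.
by apply/nondecreasing_series => k _ _; exact: exprn_ge0 (cabs_ge0 _).
Qed.

Lemma weightsT_bounded (R : realType) (s t q : R) :
  0 < s -> 0 < t -> 0 < q < 1 -> bounded_weights (fun k => (weightsT s t q k)%:C).
Proof.
move=> s0 t0 /andP[q0 q1]; exists (1 + s + t) => k.
have qk : q ^+ k <= 1 by rewrite exprn_ile1 // ltW.
have qk0 : 0 < q ^+ k by exact: exprn_gt0.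
rewrite cabs_real /weightsT.
by case: ifP => _; [|case: ifP => _]; rewrite gtr0_norm ?mulr_gt0 //; nra.
Qed.

Lemma weightsS_bounded (R : realType) (s t q : R) :
  0 < q < 1 -> bounded_weights (fun k => (weightsS s t q k)%:C).
Proof.
move=> /andP[q0 q1]; exists (1 + Num.sqrt (t / s)) => k.
have qk : q ^+ k <= 1 by rewrite exprn_ile1 // ltW.
have qk0 : 0 < q ^+ k by exact: exprn_gt0.
have r0 : 0 <= Num.sqrt (t / s) by exact: sqrtr_ge0.
rewrite cabs_real /weightsS; case: ifP => _; rewrite ger0_norm; [lra| |nra|].
- exact: ltW.
- by rewrite mulr_ge0 // ltW.
Qed.

(* Main.v *)
(* (a) The unit vector [x k = sqrt (1 - z) * sqrt z ^+ k] turns the quadratic form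
   of [T] into [(1 - z) * sqrt z * \sum_k w k * z ^+ k], whose coefficients are
   4-periodic up to the geometric factor [q ^+ k].

   (b) This is Yamazaki's inequality [w(T) <= |T| / 2 + w(T') / 2], where [T'] is
   the Aluthge transform of [T]: for a weighted shift with weights [w k], [T'] is
   the weighted shift with weights [sqrt (w k * w k.+1)], here [sqrt (s * q)]
   times the weights of [S]. Generalized polarization reads
   [w k * a k * a k.+1 <= y k ^+ 2 / 4] with [y k = sqrt (w k) * (a k + a k.+1)];
   pairing [y] with itself and moving the factors to the vector [a] gives
   [|y| ^+ 2 <= |a| * |v|] with [v k = sqrt (w k) * y k + sqrt (w k.-1) * y k.-1],
   and [|v| ^+ 2 <= 2 * (|T| + w(T')) * |y| ^+ 2]. *)
Require Import Defs.
From mathcomp Require Import all_boot all_order all_algebra.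
From mathcomp Require Import all_classical all_reals all_analysis.
From mathcomp Require Import complex ring lra zify.

Import Order.TTheory GRing.Theory Num.Theory.
Import numFieldNormedType.Exports.

Local Open Scope ring_scope.
Local Open Scope classical_set_scope.
Local Open Scope complex_scope.

(** * Numerical radius of a shift and its finite sections *)

Lemma cabs_complex (R : realType) (z : R[i]) : (cabs z)%:C = `|z|.
Proof. by rewrite /cabs RRe_real ?normr_real. Qed.

Lemma le_numerical_radius (R : realType) (w x : nat -> R) (L : R) :
  series (fun k => x k ^+ 2) @ \oo --> (1 : R) ->
  series (fun k => w k * (x k * x k.+1)) @ \oo --> L ->
  (L%:E <= numerical_radius (weighted_shift (fun k => (w k)%:C)))%E.
Proof.
move=> x1 xL; pose X k := (x k)%:C.
have sX : series (fun k => cabs (X k) ^+ 2) = series (fun k => x k ^+ 2).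
  by congr series; apply/funext => k; rewrite cabs_real real_normK ?num_real.
have dot : l2dot (weighted_shift (fun k => (w k)%:C) X) X = L%:C.
  apply: (@cvg_lim R[i]^o); first exact: norm_hausdorff.
  rewrite -(cvg_shiftS (_ : nat -> R[i]^o)) /=.
  rewrite [X in X @ _ --> _](_ : _ =
    fun n => ((series (fun k => w k * (x k * x k.+1)) n)%:C : R[i]^o)).
    exact: cvg_real_complex.
  apply/funext => n; rewrite /series /= big_nat_recl //= mul0r add0r.
  rewrite rmorph_sum; apply: eq_bigr => k _ /=.
  rewrite [X in _ * X](_ : _ = X k.+1); last exact: conjc_real.
  by rewrite -mulrA !rmorphM.
apply: (@le_trans _ _ `|L|%:E); first by rewrite lee_fin ler_norm.
apply: ereal_sup_ubound; exists X => /=.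
  split; first by rewrite /l2 /= sX; apply/cvg_ex; exists 1.
  by rewrite /l2norm sX (cvg_lim _ x1) ?sqrtr1.
by rewrite dot cabs_real.
Qed.

(** With nonnegative weights, the triangle inequality replaces a complex vector by its moduli, so
    bounds on real finite sections suffice. If the form exceeded [B] in modulus at some unit vector,
    so would one of its partial sums. *)
Lemma numerical_radius_le (R : realType) (w : nat -> R) (B : R) :
  bounded_weights (fun k => (w k)%:C) -> (forall k, 0 <= w k) -> 0 <= B ->
  (forall (a : nat -> R) n, \sum_(0 <= k < n) w k * (a k * a k.+1) <=
     B * \sum_(0 <= k < n.+1) a k ^+ 2) ->
  (numerical_radius (weighted_shift (fun k => (w k)%:C)) <= B%:E)%E.
Proof.
move=> wb w0 B0 wB; apply: ub_ereal_sup => _ [x [lx x1] <-].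
rewrite lee_fin leNgt; apply/negP => Blt.
have /cvg_ex[l xl] := is_cvg_l2dot (weighted_shift_l2 wb lx) lx.
have dotl : l2dot (weighted_shift (fun k => (w k)%:C) x) x = l.
  by apply: (@cvg_lim R[i]^o) => //; exact: norm_hausdorff.
rewrite dotl in Blt.
have e0 : 0 < (cabs l - B)%:C by rewrite ltcR subr_gt0.
(* The index [N.+1] makes the partial sum nonempty: its first term is zero, which leaves exactly [N]
   products of neighbours. *)
have /cvgrPdist_lt/(_ _ e0)[N _ /(_ N.+1 (leqnSn N))] := xl.
set u := series _ _ => lu.
have uB : cabs u <= B.
  have usum : cabs u <= \sum_(0 <= k < N) w k * (cabs (x k) * cabs (x k.+1)).
    rewrite /u /series /= big_nat_recl //= mul0r add0r -lecR cabs_complex.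
    apply: le_trans (ler_norm_sum _ _ _) _.
    rewrite rmorph_sum; apply: ler_sum => k _.
    rewrite !normrM norm_conjC !rmorphM -!cabs_complex cabs_real mulrA.
    by rewrite ger0_norm.
  apply: le_trans usum (le_trans (wB _ _) _).
  rewrite -[leRHS]mulr1 ler_wpM2l //.
  have -> : 1 = limn (series (fun k => cabs (x k) ^+ 2)).
    rewrite -[LHS](expr1n _ 2) -x1 sqr_sqrtr //.
    apply: limr_ge => //; apply: nearW => n; apply: sumr_ge0 => k _.
    exact: exprn_ge0 (cabs_ge0 _).
  apply: (nondecreasing_cvgn_le _ lx N.+1).
  by apply/nondecreasing_series => k _ _; exact: exprn_ge0 (cabs_ge0 _).
have : (cabs l)%:C <= `|l - u| + (cabs u)%:C.
  by rewrite !cabs_complex -{1}(subrK u l); exact: ler_normD.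
apply/negP; rewrite lt_geF //.
have uB' : (cabs u)%:C <= B%:C by rewrite lecR.
apply: lt_le_trans (ltr_leD lu uB') _.
by rewrite -rmorphD /= subrK.
Qed.

(** Truncating [y] after index [n] and normalising gives a finitely supported test vector. *)
Lemma sum_le_numerical_radius (R : realType) (w y : nat -> R) (c : R) n :
  (numerical_radius (weighted_shift (fun k => (w k)%:C)) <= c%:E)%E ->
  \sum_(0 <= k < n) w k * (y k * y k.+1) <= c * \sum_(0 <= k < n.+1) y k ^+ 2.
Proof.
move=> wc; set Y := \sum_(0 <= k < n.+1) _.
have Y0 : 0 <= Y by apply: sumr_ge0 => k _; exact: sqr_ge0.
(* If [Y] is zero, normalisation is impossible, but then [y] vanishes up to [n] and both sides are
   zero. *)
have [YE|Yneq] := eqVneq Y 0.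
  have y0 k : (k < n.+1)%N -> y k = 0.
    move=> kn; apply/eqP; rewrite -sqrf_eq0 eq_le sqr_ge0 andbT -YE /Y.
    rewrite (big_cat_nat _ (n := k)) //=; last exact: ltnW.
    rewrite [X in _ <= _ + X]big_ltn // addrCA lerDl addr_ge0 //;
      by apply: sumr_ge0 => j _; exact: sqr_ge0.
  rewrite YE mulr0 big_nat big1 // => k /andP[_ kn].
  by rewrite y0 ?mul0r ?mulr0 // ltnS ltnW.
have Ygt0 : 0 < Y by rewrite lt_def Yneq.
pose x k := if (k < n.+1)%N then y k / Num.sqrt Y else 0.
have YY : (Num.sqrt Y)^-1 * (Num.sqrt Y)^-1 = Y^-1.
  by rewrite -invfM -expr2 sqr_sqrtr.
have const (f : nat -> R) : (forall k, (n < k)%N -> f k = 0) ->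
    series f @ \oo --> \sum_(0 <= k < n.+1) f k.
  move=> f0; apply: cvg_near_cst; exists n.+1 => // m /= nm.
  have tail0 : \sum_(n.+1 <= k < m) f k = 0.
    by rewrite big_nat big1 // => k /andP[nk _]; exact: f0.
  by rewrite /series /= (big_cat_nat _ nm) //= tail0 addr0.
have : ((\sum_(0 <= k < n) w k * (y k * y k.+1) / Y)%:E <= c%:E)%E.
  apply: le_trans wc; apply: (@le_numerical_radius _ _ x).
  - have -> : 1 = \sum_(0 <= k < n.+1) x k ^+ 2.
      rewrite -(divff Yneq) {1}/Y mulr_suml; apply: eq_big_nat => k /andP[_ kn].
      by rewrite /x kn exprMn [(_ ^-1)^+ 2]expr2 YY.
    by apply: const => k nk; rewrite /x ltnNge nk expr0n.
  - have -> : \sum_(0 <= k < n) w k * (y k * y k.+1) / Y =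
              \sum_(0 <= k < n.+1) w k * (x k * x k.+1).
      have xn : x n.+1 = 0 by rewrite /x ltnn.
      rewrite [RHS]big_nat_recr //= xn !mulr0 addr0.
      apply: eq_big_nat => k /andP[_ kn].
      by rewrite /x ltnS (ltnW kn) ltnS kn mulrACA YY -!mulrA.
    by apply: const => k nk; rewrite /x ltnNge nk mul0r mulr0.
by rewrite lee_fin -mulr_suml ler_pdivrMr.
Qed.

(** * Yamazaki's inequality on finite sections *)

Lemma aluthge_bound (R : realType) (w : nat -> R) (M c : R) :
  0 < M -> 0 <= c -> (forall k, 0 <= w k <= M) ->
  (forall (y : nat -> R) n,
     \sum_(0 <= k < n) Num.sqrt (w k * w k.+1) * (y k * y k.+1) <=
     c * \sum_(0 <= k < n.+1) y k ^+ 2) ->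
  forall (a : nat -> R) n, \sum_(0 <= k < n) w k * (a k * a k.+1) <=
     (M + c) / 2 * \sum_(0 <= k < n.+1) a k ^+ 2.
Proof.
move=> M0 c0 wM yc a n; set A := \sum_(0 <= k < n.+1) a k ^+ 2.
pose b k := Num.sqrt (w k).
have bb k : b k ^+ 2 = w k by rewrite sqr_sqrtr //; case/andP: (wM k).
(* Cutting [y] off at [n] removes the boundary terms from the summations by parts below. *)
pose y k := if (k < n)%N then b k * (a k + a k.+1) else 0.
pose h k := b k * y k.
(* [h + g] is the vector obtained by applying to [y] the adjoint of [a |-> y]. *)
pose g k := if k is j.+1 then h j else 0.
have yn : y n = 0 by rewrite /y ltnn.
have hn : h n = 0 by rewrite /h yn mulr0.
set E := \sum_(0 <= k < n.+1) y k ^+ 2.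
have E_lt : E = \sum_(0 <= k < n) y k ^+ 2.
  by rewrite /E big_nat_recr //= yn expr0n addr0.
have EE : E = \sum_(0 <= k < n.+1) a k * (h k + g k).
  under eq_bigr do rewrite mulrDr.
  rewrite big_split /= big_nat_recr //= hn mulr0 addr0.
  rewrite [X in _ + X]big_nat_recl //= mulr0 add0r -big_split /= E_lt.
  apply: eq_big_nat => k /andP[_ kn]; rewrite /h /y kn; ring.
have FE : \sum_(0 <= k < n.+1) (h k + g k) ^+ 2 <= 2 * (M + c) * E.
  have -> : \sum_(0 <= k < n.+1) (h k + g k) ^+ 2 =
      2 * \sum_(0 <= k < n) h k ^+ 2 + 2 * \sum_(0 <= k < n) h k * h k.+1.
    under eq_bigr do rewrite sqrrD.
    rewrite !big_split /= [X in X + _ + _]big_nat_recr //= hn expr0n addr0.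
    rewrite [X in _ + X]big_nat_recl //= expr0n add0r.
    have -> : \sum_(0 <= k < n.+1) h k * g k = \sum_(0 <= k < n) h k * h k.+1.
      rewrite big_nat_recl //= mulr0 add0r.
      by apply: eq_bigr => k _; rewrite mulrC.
    by ring.
  have H1 : \sum_(0 <= k < n) h k ^+ 2 <= M * E.
    rewrite E_lt mulr_sumr; apply: ler_sum => k _.
    by rewrite exprMn bb ler_wpM2r ?sqr_ge0 //; case/andP: (wM k).
  (* The factors [b k * b k.+1] are the Aluthge weights, so the cross terms are the quadratic form
     that [yc] bounds. *)
  have H2 : \sum_(0 <= k < n) h k * h k.+1 <= c * E.
    apply: le_trans (yc y n); rewrite le_eqVlt; apply/orP; left; apply/eqP.
    apply: eq_bigr => k _; rewrite sqrtrM; last by case/andP: (wM k).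
    by rewrite /h mulrACA.
  lra.
set K := 2 * (M + c) in FE.
have K0 : 0 < K by rewrite /K; lra.
have EA : E <= K * A.
  (* AM-GM: [2 a f <= K a^2 + f^2 / K] *)
  have : 2 * E <= K * A + K^-1 * \sum_(0 <= k < n.+1) (h k + g k) ^+ 2.
    rewrite {1}EE !mulr_sumr -big_split /=; apply: ler_sum => k _.
    set f := h k + g k; rewrite -subr_ge0.
    have -> : K * a k ^+ 2 + K^-1 * f ^+ 2 - 2 * (a k * f) =
              K^-1 * (K * a k - f) ^+ 2 by field; exact: lt0r_neq0.
    by rewrite mulr_ge0 ?sqr_ge0 ?invr_ge0 ?ltW.
  have : K^-1 * \sum_(0 <= k < n.+1) (h k + g k) ^+ 2 <= E.
    by rewrite ler_pdivrMl.
  lra.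
(* This is [4 * u * v <= (u + v) ^+ 2] termwise; together with [EA], the constant becomes
   [K / 4 = (M + c) / 2]. *)
have : \sum_(0 <= k < n) w k * (a k * a k.+1) <= 4^-1 * E.
  rewrite E_lt mulr_sumr; apply: ler_sum_nat => k /andP[_ kn].
  rewrite /y kn exprMn bb; case/andP: (wM k) => wk0 _.
  rewrite [leRHS]mulrCA ler_wpM2l //.
  have := sqr_ge0 (a k - a k.+1); lra.
rewrite /K in EA; lra.
Qed.

(** * The weights of [T] and their periodic coefficients *)

Definition coefT {R : realType} (s t : R) (k : nat) : R :=
  if (k %% 4 == 1)%N then s else if (k %% 4 == 3)%N then t else 1.

Lemma weightsTE (R : realType) (s t q : R) k :
  weightsT s t q k = coefT s t k * q ^+ k.
Proof. by rewrite /weightsT /coefT; do 2?case: ifP; rewrite ?mul1r. Qed.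

Lemma coefTD4 (R : realType) (s t : R) k : coefT s t k.+4 = coefT s t k.
Proof. by rewrite /coefT -(addn4 k) modnDr. Qed.

Lemma coefT_bounds {R : realType} {s t : R} k : 0 < s -> 0 < t ->
  0 <= coefT s t k <= 1 + s + t.
Proof. by rewrite /coefT; do 2?case: ifP => _; move=> s0 t0; lra. Qed.

(* [(coefT s t n + ... + coefT s t n.+3 * y ^+ 3) * y ^+ n / (1 - y ^+ 4)] is the
   remainder of the series, because the coefficients are 4-periodic. *)
Lemma cvg_series_coefT (R : realType) (s t y : R) :
  0 < s -> 0 < t -> 0 < y -> y < 1 ->
  series (fun k => coefT s t k * y ^+ k) @ \oo -->
    (1 + s * y + y ^+ 2 * (1 + t * y)) / (1 - y ^+ 4).
Proof.
move=> s0 t0 y0 y1; set L := _ / _.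
have D0 : 0 < 1 - y ^+ 4 by rewrite subr_gt0 exprn_ilt1 // ltW.
pose d n := (coefT s t n + coefT s t n.+1 * y + coefT s t n.+2 * y ^+ 2
             + coefT s t n.+3 * y ^+ 3) / (1 - y ^+ 4).
have Sn n : series (fun k => coefT s t k * y ^+ k) n = L - d n * y ^+ n.
  elim: n => [|n IHn].
    rewrite /series /= big_geq // /L /d /coefT /= expr0 mulr1; apply/esym/eqP.
    rewrite subr_eq0; apply/eqP; congr (_ / _); ring.
  rewrite seriesSr.
  rewrite IHn /d coefTD4 (exprS y n); field; exact: lt0r_neq0.
rewrite (funext Sn) -[X in _ --> X]subr0.
apply: cvgB; first exact: cvg_cst.
(* Each of the four terms in the numerator of [d n] is at most [1 + s + t], so the remainder is
   dominated by a geometric sequence. *)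
apply: (@squeeze_cvgr _ _ _ _ (fun=> 0)
  (fun n => (4 * (1 + s + t)) / (1 - y ^+ 4) * y ^+ n)); last 2 first.
- exact: cvg_cst.
- by apply: cvg_geometric; rewrite gtr0_norm.
apply: nearW => n.
have cy k j : 0 <= coefT s t k * y ^+ j <= 1 + s + t.
  have /andP[ck0 ck1] := coefT_bounds k s0 t0.
  rewrite mulr_ge0 ?exprn_ge0 ?(ltW y0) //=.
  by rewrite -[leRHS]mulr1 ler_pM ?exprn_ge0 ?exprn_ile1 ?(ltW y0) ?(ltW y1).
have := (cy n 0, cy n.+1 1, cy n.+2 2, cy n.+3 3)%N.
rewrite expr0 mulr1 expr1 => -[[[h0 h1] h2] h3].
rewrite mulr_ge0 ?exprn_ge0 ?(ltW y0) //=; last first.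
  by rewrite /d divr_ge0 ?(ltW D0) //; lra.
rewrite ler_wpM2r ?exprn_ge0 ?(ltW y0) // /d ler_wpM2r ?invr_ge0 ?(ltW D0) //.
lra.
Qed.

Lemma weightsT_ge0 (R : realType) (s t q : R) k :
  0 < s -> 0 < t -> 0 < q -> 0 <= weightsT s t q k.
Proof.
move=> s0 t0 q0; rewrite weightsTE mulr_ge0 ?exprn_ge0 ?(ltW q0) //.
by case/andP: (coefT_bounds k s0 t0).
Qed.

(** Powers of [q] decrease, so each kind of coefficient has its largest weight at its first index:
    0, 1 or 3. *)
Lemma weightsT_le_max (R : realType) (s t q : R) k :
  0 < s -> 0 < t -> 0 < q -> q < 1 ->
  weightsT s t q k <= Num.max 1 (Num.max (s * q) (t * q ^+ 3)).
Proof.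
move=> s0 t0 q0 q1; have qX m n : (m <= n)%N -> q ^+ n <= q ^+ m.
  by move=> mn; rewrite ler_wiXn2l ?ltW.
rewrite /weightsT !le_max; case: ifP => [k1|_]; [|case: ifP => [k3|_]].
- by rewrite ler_pM2l // (qX 1%N) ?orbT //; lia.
- by rewrite ler_pM2l // (qX 3%N) ?orbT //; lia.
- by rewrite (qX 0%N).
Qed.

(** Of two consecutive coefficients one is 1 and the other is [s] if [k %% 4 < 2], else [t]; the
    powers of [q] multiply to [q * (q ^+ k) ^+ 2]. *)
Lemma aluthge_weightsT (R : realType) (s t q : R) k :
  0 < s -> 0 < t -> 0 < q ->
  Num.sqrt (weightsT s t q k * weightsT s t q k.+1) =
  Num.sqrt (s * q) * weightsS s t q k.
Proof.
move=> s0 t0 q0.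
have qk0 : 0 <= q ^+ k by rewrite exprn_ge0 ?ltW.
have sq0 : 0 <= s * q by rewrite mulr_ge0 ?ltW.
have st : Num.sqrt (s * q) * Num.sqrt (t / s) = Num.sqrt (t * q).
  by rewrite -sqrtrM //; congr Num.sqrt; field; exact: lt0r_neq0.
have sqrtX (u : R) : 0 <= u -> Num.sqrt (u * (q ^+ k) ^+ 2) = Num.sqrt u * q ^+ k.
  by move=> u0; rewrite sqrtrM // sqrtr_sqr ger0_norm.
rewrite /weightsS; case: ifP => k4.
  rewrite -sqrtX // !weightsTE; congr Num.sqrt.
  have coefE : coefT s t k * coefT s t k.+1 = s.
    rewrite /coefT; have [k0|k0] : (k %% 4 = 0 \/ k %% 4 = 1)%N by lia.
    - have -> : (k.+1 %% 4 = 1)%N by lia.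
      by rewrite k0 /= mul1r.
    - have -> : (k.+1 %% 4 = 2)%N by lia.
      by rewrite k0 /= mulr1.
  rewrite exprS -[in RHS]coefE; ring.
rewrite mulrA st -sqrtX ?mulr_ge0 ?ltW // !weightsTE; congr Num.sqrt.
have coefE : coefT s t k * coefT s t k.+1 = t.
  rewrite /coefT; have [k0|k0] : (k %% 4 = 2 \/ k %% 4 = 3)%N by lia.
  - have -> : (k.+1 %% 4 = 3)%N by lia.
    by rewrite k0 /= mul1r.
  - have -> : (k.+1 %% 4 = 0)%N by lia.
    by rewrite k0 /= mulr1.
rewrite exprS -[in RHS]coefE; ring.
Qed.

(** * The two bounds for [T] *)

Theorem theorem2p2 (R : realType) (s t q : R)
    (s_gt0 : 0 < s) (t_gt0 : 0 < t) (q_gt0 : 0 < q) (q_lt1 : q < 1) :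
  let T := weighted_shift (fun k => (weightsT s t q k)%:C) in
  let S := weighted_shift (fun k => (weightsS s t q k)%:C) in
  (ereal_sup [set ((1 - z) * Num.sqrt z / (1 - q ^+ 4 * z ^+ 4) *
                   ((1 + s * q * z) + q ^+ 2 * z ^+ 2 * (1 + t * q * z)))%:E
             | z in [set z : R | (0 < z < 1)%R]]
     <= numerical_radius T)%E
  /\
  (numerical_radius T
     <= (2^-1 * Num.max 1 (Num.max (s * q) (t * q ^+ 3)))%:E
        + (Num.sqrt (s * q) / 2)%:E * numerical_radius S)%E.
Proof.
move=> T S; split.
  apply: ub_ereal_sup => _ [z /= /andP[z0 z1] <-].
  have z1' : 0 <= 1 - z by rewrite subr_ge0 ltW.
  have zz := sqr_sqrtr (ltW z0); have zz1 := sqr_sqrtr z1'.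
  apply: (@le_numerical_radius _ _ (fun k => Num.sqrt (1 - z) * Num.sqrt z ^+ k)).
    have -> : (fun k => (Num.sqrt (1 - z) * Num.sqrt z ^+ k) ^+ 2) =
              geometric (1 - z) z.
      by apply/funext => k; rewrite /geometric /= exprMn zz1 exprAC zz.
    rewrite [X in _ --> X](_ : 1 = (1 - z) * (1 - z)^-1); last first.
      by rewrite divff // gt_eqF // subr_gt0.
    by apply: cvg_geometric_series; rewrite gtr0_norm.
  have qz0 : 0 < q * z by rewrite mulr_gt0.
  have qz1 : q * z < 1 by rewrite mulr_ilt1 ?ltW.
  (* Since [Num.sqrt z ^+ k * Num.sqrt z ^+ k.+1] is [Num.sqrt z * z ^+ k], the form is a multiple
     of the coefficient series at [q * z]. *)
  rewrite [X in series X](_ : _ =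
    (fun k => ((1 - z) * Num.sqrt z) *: (coefT s t k * (q * z) ^+ k))); last first.
    apply/funext => k; have zk : (Num.sqrt z ^+ k) ^+ 2 = z ^+ k by rewrite exprAC zz.
    rewrite weightsTE exprS exprMn -zk -[X in (X * _) *: _]zz1 /GRing.scale /=; ring.
  rewrite [X in _ --> X](_ : _ = ((1 - z) * Num.sqrt z) *:
    ((1 + s * (q * z) + (q * z) ^+ 2 * (1 + t * (q * z))) / (1 - (q * z) ^+ 4))).
    rewrite [X in X @ _](_ : _ = fun n => ((1 - z) * Num.sqrt z) *:
      series (fun k => coefT s t k * (q * z) ^+ k) n); last first.
      by apply/funext => n; rewrite /series /= scaler_sumr.
    by apply: cvgZr; exact: cvg_series_coefT.
  rewrite /GRing.scale /= !exprMn mulrAC -!mulrA.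
  by do 2 congr (_ * _); rewrite mulrC; congr (_ * _); ring.
set M := Num.max _ _.
have M0 : 0 < M by rewrite /M lt_max ltr01.
have sq0 : 0 < Num.sqrt (s * q) by rewrite sqrtr_gt0 mulr_gt0.
(* The first basis vector gives the value 0. This rules out [-oo] and supplies [0 <= c] in the
   finite case. *)
have S0 : (0 <= numerical_radius S)%E.
  apply: (@le_numerical_radius _ _ (fun k => (k == 0)%:R)).
    apply: cvg_near_cst; exists 1%N => // -[//|n] _.
    rewrite /series /= big_nat_recl //= expr1n big1 ?addr0 // => k _.
    by rewrite expr0n.
  rewrite [X in series X](_ : _ = fun=> 0).
    by apply: cvg_near_cst; apply: nearW => n; rewrite /series /= big1.
  by apply/funext => k; rewrite /= !mulr0.
have := @sum_le_numerical_radius R (weightsS s t q).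
rewrite -/S; case: (numerical_radius S) S0 => [c| |].
- rewrite lee_fin => c0 Sc; rewrite -EFinM -EFinD.
  rewrite (_ : _ + _ = (M + Num.sqrt (s * q) * c) / 2); last by field.
  have sqc0 : 0 <= Num.sqrt (s * q) * c by rewrite mulr_ge0 // ltW.
  apply: numerical_radius_le.
  + by apply: weightsT_bounded => //; rewrite q_gt0.
  + by move=> k; exact: weightsT_ge0.
  + by rewrite divr_ge0 // addr_ge0 // ltW.
  (* The Aluthge transform is [Num.sqrt (s * q)] times [S], so its sections are bounded by
     [Num.sqrt (s * q) * c]. *)
  apply: aluthge_bound => // [k|y n].
    by rewrite weightsT_ge0 //= weightsT_le_max.
  under eq_bigr do rewrite aluthge_weightsT // -mulrA.
  by rewrite -mulr_sumr -mulrA ler_pM2l //; exact: Sc.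
- by move=> _ _; rewrite mulry gtr0_sg ?divr_gt0 // mul1e addey // leey.
- by [].
Qed.
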